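(* Let $K=\mathbb F_3(t)$, $c=\dfrac{t^2+t+2}{t(t+1)^2}\in K$, and $f(x)=cx^2+t\in K[x]$. Let $\mathcal G_2=\operatorname{Gal}(\operatorname{Spl}_K(f^{\circ 2})/K)$. Then the second-level arboreal Galois group $\mathcal G_2$ is strictly smaller than the full wreath product: $\mathcal G_2\not\cong C_2\wr C_2$.
   Context: $f^{\circ 2}=f\circ f$, and $\operatorname{Spl}_K(g)$ denotes the splitting field of $g$ over $K$. $C_2\wr C_2=(C_2)^2\rtimes C_2$, with $C_2$ acting by swapping the two factors (a group of order $8$). *)

(* Defs.v *)
From HB Require Import structures.
From mathcomp Require Import all_boot all_order all_fingroup all_algebra.
From mathcomp Require Import all_solvable all_field.

Set Implicit Arguments.
Unset Strict Implicit.
Unset Printing Implicit Defensive.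

Import GRing.Theory.

Local Open Scope ring_scope.

Definition K : fieldType := {fraction {poly 'F_3}}.

Definition t : K := tofrac ('X : {poly 'F_3}).

Definition c : K := (t ^+ 2 + t + 2%:R) / (t * (t + 1) ^+ 2).

Definition f : {poly K} := c *: 'X^2 + t%:P.

Local Close Scope ring_scope.

(* The regular wreath product gT wr C_2 = (gT x gT) ><| C_2, where C_2 is the
   additive group 'Z_2, whose nonzero element swaps the two coordinates. *)
Section WreathC2.

Variable gT : finGroupType.

Local Open Scope group_scope.

Definition swap (x : gT * gT) (a : 'Z_2) : gT * gT :=
  if a == 0%R then x else (x.2, x.1).

Lemma swap1 : swap^~ 1 =1 id.
Proof. by []. Qed.

Lemma swapM x : act_morph swap x.
Proof.
case: x => x1 x2 a b.
by case: a b => [[|[|a]] // ?] [[|[|b]] // ?].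
Qed.

Definition swap_action : {action 'Z_2 &-> gT * gT} := TotalAction swap1 swapM.

Lemma swap_is_groupAction : is_groupAction [set: gT * gT] swap_action.
Proof.
move=> a _; rewrite inE; apply/andP; split.
  by apply/subsetP=> x; rewrite inE.
apply/morphicP=> x y _ _; rewrite !actpermE /= /swap.
by case: (a == 0%R).
Qed.

Definition swap_groupAction : groupAction [set: 'Z_2] [set: gT * gT] :=
  GroupAction swap_is_groupAction.

Definition wreathC2 : finGroupType := sdprod_groupType swap_groupAction.

End WreathC2.

Definition C2wrC2 : finGroupType := wreathC2 'Z_2.

(* Main.v *)
(** With [u ^ 2 = - t / c], the zeros of [f \Po f] are the [x] with
    [c x ^ 2 + t = u] or [c x ^ 2 + t = - u]. If [x] and [y] lie over [u] and
    [- u], then [(c x y) ^ 2 = t ^ 2 + t / c]. For this particular [c] one finds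
    [t ^ 2 + t / c = (t / (t + 1)) ^ 2 * (- t / c)] in characteristic 3, so
    [c x y] is [t / (t + 1) * u] up to sign. Hence every zero lies in [K(x)],
    whose degree is at most 4, while [C_2 wr C_2] has order 8. *)

Require Import Defs.
From mathcomp Require Import all_boot all_order all_fingroup all_algebra.
From mathcomp Require Import all_solvable all_field.
From mathcomp Require Import ring.

Set Implicit Arguments.
Unset Strict Implicit.
Unset Printing Implicit Defensive.

Import GRing.Theory.
Local Open Scope ring_scope.

Lemma card_wreathC2 (gT : finGroupType) :
  #|[set: wreathC2 gT]| = ((#|gT| ^ 2).*2)%N.
Proof.
rewrite -(sdprod_card (sdprod_sdpair (swap_groupAction gT))).
rewrite !card_injm ?injm_sdpair1 ?injm_sdpair2 ?subxx //.
by rewrite !cardsT card_prod card_ord muln2 mulnn.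
Qed.

Section QuadraticIterate.

Variables (F : fieldType) (a b k : F).
Hypotheses (a0 : a != 0) (b0 : b != 0) (k0 : k != 0).
(** With [u ^ 2 = - (b / a)] this reads [b ^ 2 - u ^ 2 = (k * u) ^ 2], phrased without [u] because
    [u] need not lie in [F]. *)
Hypothesis abk : b ^+ 2 + b / a = k ^+ 2 * - (b / a).

Local Notation g := (a *: 'X^2 + b%:P).

Lemma size_quadratic_iterate : size (g \Po g) = 5%N.
Proof.
have sg : size g = 3%N.
  rewrite size_polyDl size_scale // size_polyXn //.
  by rewrite (leq_ltn_trans (size_polyC_leq1 _)).
(* [size_comp_poly] only gives the predecessor of the size, here 4; size 0 is excluded because its
   predecessor is 0. *)
by have := size_comp_poly g g; rewrite sg; case: size => // n /= ->.
Qed.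

Section Roots.

Variable L : fieldExtType F.

Local Notation P := (map_poly (in_alg L) (g \Po g)).

Lemma root_quadratic_iterate (x : L) :
  root P x -> (a%:A * x ^+ 2 + b%:A) ^+ 2 = - (b / a)%:A.
Proof.
have aA0 : a%:A != 0 :> L by rewrite scaler_eq0 oner_eq0 orbF.
have gE (y : L) : (map_poly (in_alg L) g).[y] = a%:A * y ^+ 2 + b%:A.
  by rewrite rmorphD /= map_polyZ map_polyXn map_polyC !hornerE.
rewrite /root map_comp_poly horner_comp !gE addr_eq0 => /eqP h.
apply: (mulfI aA0); rewrite h mulrN -[_ * _](rmorphM (in_alg L)).
by rewrite mulrCA divff ?mulr1.
Qed.

Lemma root_quadratic_iterate_adjoin (x y : L) :
  root P x -> root P y -> y \in <<1; x>>%VS.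
Proof.
move=> /root_quadratic_iterate rx /root_quadratic_iterate ry.
have inA (d : F) : d%:A \in <<1; x>>%VS by rewrite rpredZ // mem1v.
have xA : x \in <<1; x>>%VS := memv_adjoin _ _.
have aA0 : a%:A != 0 :> L by rewrite scaler_eq0 oner_eq0 orbF.
have kA0 : k%:A != 0 :> L by rewrite scaler_eq0 oner_eq0 orbF.
have baA0 : (b / a)%:A != 0 :> L.
  by rewrite scaler_eq0 oner_eq0 orbF mulf_neq0 ?invr_eq0.
have abkA := congr1 (in_alg L) abk.
rewrite mulrN rmorphD rmorphN [X in _ = - X]rmorphM !rmorphXn /= in abkA.
have uA : a%:A * x ^+ 2 + b%:A \in <<1; x>>%VS.
  by rewrite rpredD ?rpredM ?rpredX.
move: rx ry uA; set u := _ + _; set v := _ + _ => ru /eqP.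
rewrite -ru eqf_sqr => /orP[/eqP vE|/eqP vE] uA.
  (* If [v = u], then [y] is [x] up to sign. *)
  have /eqP : y ^+ 2 = x ^+ 2 by apply: (mulfI aA0); apply: (addIr b%:A).
  by rewrite eqf_sqr => /orP[] /eqP ->; rewrite ?rpredN.
(* Now [v = - u], so the left side is [(u - b) * (- u - b) = b ^ 2 - u ^ 2]. *)
have axy : (a%:A * x * y) ^+ 2 = (k%:A * u) ^+ 2.
  rewrite [RHS]exprMn ru mulrN -abkA -[(b / a)%:A]opprK -ru.
  have -> : (a%:A * x * y) ^+ 2 = (u - b%:A) * (v - b%:A).
    by rewrite /u /v !addrK; ring.
  by rewrite vE; ring.
have u0 : u != 0 by rewrite -sqrf_eq0 ru oppr_eq0.
(* This permits solving for [y]: [x = 0] would force [k * u = 0]. *)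
have ax0 : a%:A * x != 0.
  apply/eqP => ax0; move/eqP: axy.
  rewrite ax0 mul0r expr0n eq_sym sqrf_eq0 mulf_eq0.
  by rewrite (negPf kA0) (negPf u0).
move/eqP: axy; rewrite eqf_sqr => axy.
have -> : y = (a%:A * x * y) / (a%:A * x) by rewrite mulrC mulKf.
by case/orP: axy => /eqP ->; rewrite ?mulNr ?rpredN rpredM ?rpredV ?rpredM.
Qed.

End Roots.

Lemma card_Gal_quadratic_iterate (L : splittingFieldType F) (E : {subfield L}) :
  splittingFieldFor 1%VS (map_poly (in_alg L) (g \Po g)) E ->
  (#|'Gal(E / 1)%g| <= 4)%N.
Proof.
set P := map_poly _ _ => -[rs Prs rsE].
have szP : size P = 5%N by rewrite size_map_poly size_quadratic_iterate.
have rP z : (z \in rs) = root P z by rewrite (eqp_root Prs) root_prod_XsubC.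
have [x xrs] : exists x, x \in rs.
  case: {rsE rP} rs Prs => [/eqp_size|x rs _].
    by rewrite szP big_nil size_poly1.
  by exists x; rewrite mem_head.
have sEx : (E <= <<1; x>>)%VS.
  rewrite -rsE; apply/Fadjoin_seqP; split=> [|z]; first exact: subv_adjoin.
  by rewrite !rP in xrs * => rz; apply: root_quadratic_iterate_adjoin xrs rz.
have dimx : (\dim <<1; x>>%VS <= 4)%N.
  (* The minimal polynomial of [x] divides [P], whose size 5 means degree 4. *)
  rewrite dim_Fadjoin dimv1 muln1 -ltnS -size_minPoly -szP.
  apply: dvdp_leq; first by rewrite -size_poly_gt0 szP.
  by apply: minPoly_dvdp; rewrite -?rP // alg_polyOver.
(* By Artin's theorem the group order is the degree of [E] over its fixed field, hence at most the
   dimension of [E]. *)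
rewrite dim_fixedField (leq_trans _ (leq_trans (dimvS sEx) dimx)) //.
exact: leq_div.
Qed.

End QuadraticIterate.

Lemma char3_square_class (F : fieldType) (T : F) :
    (3%:R : F) = 0 -> T != 0 -> T + 1 != 0 -> T ^+ 2 + T + 2%:R != 0 ->
  let C := (T ^+ 2 + T + 2%:R) / (T * (T + 1) ^+ 2) in
  T ^+ 2 + T / C = (T / (T + 1)) ^+ 2 * - (T / C).
Proof.
move=> h3 T0 T1 n0 C; apply/eqP; rewrite -subr_eq0; apply/eqP.
(* Over the common denominator [T ^ 2 + T + 2], the numerator is [T ^ 2] times [(T ^ 2 + T + 2) + (T
   + 1) ^ 2 + T ^ 2 = 3 * (T ^ 2 + T + 1)]. *)
suff -> : T ^+ 2 + T / C - (T / (T + 1)) ^+ 2 * - (T / C) =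
  3%:R * (T ^+ 2 * (T ^+ 2 + T + 1) / (T ^+ 2 + T + 2%:R)).
  by rewrite h3 mul0r.
rewrite /C; field.
by rewrite n0 T0 T1.
Qed.

(** Reduces the nonvanishing of [t], [t + 1] and the numerator of [c] to monicity of polynomials
    over ['F_3]. *)
Lemma tofrac_monic_neq0 (R : idomainType) (p : {poly R}) :
  p \is monic -> tofrac p != 0.
Proof. by move=> pm; rewrite tofrac_eq0 monic_neq0. Qed.

Lemma t_neq0 : t != 0.
Proof. exact/tofrac_monic_neq0/monicX. Qed.

Lemma tD1_neq0 : t + 1 != 0.
Proof.
rewrite /t -(rmorph1 (@tofrac {poly 'F_3})) -rmorphD tofrac_monic_neq0 //.
by rewrite -[1]polyC1 -[1%:P]opprK -polyCN monicXsubC.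
Qed.

Lemma numer_c_neq0 : t ^+ 2 + t + 2%:R != 0.
Proof.
rewrite /t -(rmorph_nat (@tofrac {poly 'F_3})) -rmorphXn -!rmorphD.
rewrite tofrac_monic_neq0 // monicE -addrA lead_coefDl ?lead_coefXn //.
by rewrite size_polyXn -polyC_natr size_XaddC.
Qed.

Lemma char_K : (3%:R : K) = 0.
Proof.
rewrite -(rmorph_nat (@tofrac {poly 'F_3})).
by rewrite -polyC_natr (_ : 3%:R = 0 :> 'F_3) ?polyC0 ?rmorph0 //; apply/val_inj.
Qed.

Local Close Scope ring_scope.

Theorem proposition6p3 (L : splittingFieldType K) (E : {subfield L})
    (splE : splittingFieldFor 1%VS (map_poly (GRing.in_alg L) (f \Po f)%R) E) :
  #|'Gal(E / 1)%g| < #|[set: C2wrC2]| /\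
  ~ ('Gal(E / 1)%g \isog [set: C2wrC2])%g.
Proof.
suff ltG : #|'Gal(E / 1)%g| < #|[set: C2wrC2]|.
  by split=> // /card_isog eqG; rewrite eqG ltnn in ltG.
have t0 := t_neq0; have t1 := tD1_neq0; have n0 := numer_c_neq0.
have c0 : (c != 0)%R.
  exact: mulf_neq0 n0 (invr_neq0 (mulf_neq0 t0 (expf_neq0 2 t1))).
have k0 : (t / (t + 1) != 0)%R := mulf_neq0 t0 (invr_neq0 t1).
have sq := char3_square_class char_K t0 t1 n0.
rewrite card_wreathC2 card_ord.
exact: leq_ltn_trans (card_Gal_quadratic_iterate c0 t0 k0 sq splE) _.
Qed.
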